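(* Let $T=\{1423,2314,2341\}$. Then $$F_T(x)=\frac{1-4x+5x^2-x^3+(1-4x+3x^2-x^3)\sqrt{1-4x}}{(1-x)(1-3x+x^2)(1-2x+\sqrt{1-4x})}.$$
   Context: $S_n(T)$ denotes the set of permutations $\pi$ of $[n]=\{1,\dots,n\}$ (one-line notation) that avoid every pattern $\tau\in T$, i.e. no subsequence of $\pi$ is order-isomorphic to $\tau$. $F_T(x)=\sum_{n\ge 0}|S_n(T)|x^n$, a formal power series, with $|S_0(T)|=1$. Here $\sqrt{1-4x}$ is the formal power series with constant term $1$ whose square is $1-4x$. *)

(* Defs.v *)
From HB Require Import structures.
From mathcomp Require Import all_boot all_order all_algebra all_fingroup.
From mathcomp Require Import boolp classical_sets.

Set Implicit Arguments.
Unset Strict Implicit.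
Unset Printing Implicit Defensive.

Import GRing.Theory Num.Theory.
Local Open Scope ring_scope.

(* Permutations of [n] are elements of ['S_n], that is, permutations of
   {0, ..., n-1}; [one_line] shifts the values so that it returns the usual
   word on {1, ..., n}. *)

Definition one_line n (p : 'S_n) : seq nat := [seq (p i).+1 | i <- enum 'I_n].

Definition order_iso (s t : seq nat) : bool :=
  (size s == size t) &&
  [forall i : 'I_(size s), forall j : 'I_(size s),
     ((nth 0 s i < nth 0 s j) == (nth 0 t i < nth 0 t j))%N].

(* The subsequences of [w] are the words [mask m w] for the boolean masks [m]
   of size [size w]; masks make the quantification finite. *)
Definition contains (w t : seq nat) : bool :=
  [exists m : (size w).-tuple bool, order_iso (mask m w) t].

Definition avoids (w : seq nat) (T : seq (seq nat)) : bool :=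
  all (fun t => ~~ contains w t) T.

Lemma containsP (w t : seq nat) :
  reflect (exists2 s, subseq s w & order_iso s t) (contains w t).
Proof.
apply: (iffP existsP) => [[m iso]|[s /subseqP[m sz_m ->] iso]].
  by exists (mask m w) => //; apply: mask_subseq.
by exists (Tuple (introT eqP sz_m)).
Qed.

Definition av (T : seq (seq nat)) (n : nat) : {set 'S_n} :=
  [set p : 'S_n | avoids (one_line p) T].

(* The ring K[[x]] with the Cauchy product.  A series is a unit exactly when its
   constant coefficient is a unit of K, and [/] is then the division of K[[x]]. *)

Record fps (K : Type) := Fps { fcoef : nat -> K }.

Lemma fpsP (K : Type) (f g : fps K) : fcoef f =1 fcoef g -> f = g.
Proof. by case: f g => [f] [g] /= /funext ->. Qed.

HB.instance Definition _ (K : Type) := gen_eqMixin (fps K).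
HB.instance Definition _ (K : Type) := gen_choiceMixin (fps K).

Section CourseOfValues.
Variables (K : nzRingType) (step : seq K -> K).

Fixpoint cov_seq n : seq K :=
  if n is n'.+1 then let s := cov_seq n' in rcons s (step s) else [::].

(* The series f such that f_n = step [:: f_0; ...; f_(n-1)]. *)
Definition fps_cov : fps K := Fps (fun n => step (cov_seq n)).

Lemma size_cov n : size (cov_seq n) = n.
Proof. by elim: n => //= n IHn; rewrite size_rcons IHn. Qed.

Lemma nth_cov n i : (i < n)%N -> (cov_seq n)`_i = fcoef fps_cov i.
Proof.
elim: n => //= n IHn; rewrite ltnS leq_eqVlt nth_rcons size_cov.
by case: eqP => [->|_ /= lt_in]; [rewrite ltnn | rewrite lt_in IHn].
Qed.

Lemma fps_covE n : fcoef fps_cov n = step (cov_seq n).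
Proof. by []. Qed.

End CourseOfValues.

Section FpsZmod.
Variable K : nzRingType.
Implicit Types f g h : fps K.

Definition fps_zero : fps K := Fps (fun=> 0).
Definition fps_opp f := Fps (fun n => - fcoef f n).
Definition fps_add f g := Fps (fun n => fcoef f n + fcoef g n).

Fact fps_addA : associative fps_add.
Proof. by move=> f g h; apply: fpsP => n /=; rewrite addrA. Qed.
Fact fps_addC : commutative fps_add.
Proof. by move=> f g; apply: fpsP => n /=; rewrite addrC. Qed.
Fact fps_add0 : left_id fps_zero fps_add.
Proof. by move=> f; apply: fpsP => n /=; rewrite add0r. Qed.
Fact fps_addN : left_inverse fps_zero fps_opp fps_add.
Proof. by move=> f; apply: fpsP => n /=; rewrite addNr. Qed.

HB.instance Definition _ :=
  GRing.isZmodule.Build (fps K) fps_addA fps_addC fps_add0 fps_addN.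

Lemma fcoef0 n : fcoef (0 : fps K) n = 0. Proof. by []. Qed.
Lemma fcoefD f g n : fcoef (f + g) n = fcoef f n + fcoef g n. Proof. by []. Qed.
Lemma fcoefN f n : fcoef (- f) n = - fcoef f n. Proof. by []. Qed.

Definition fpsX : fps K := Fps (fun n => (n == 1%N)%:R).

End FpsZmod.

Arguments fpsX {K}.

Section FpsRing.
Variable K : comNzRingType.
Implicit Types f g h : fps K.

Definition fps_one : fps K := Fps (fun n => (n == 0%N)%:R).
Definition fps_mul f g : fps K :=
  Fps (fun n => \sum_(i < n.+1) fcoef f i * fcoef g (n - i)).

Definition fps_trunc N f : {poly K} := \poly_(i < N) fcoef f i.

Lemma fps_mul_trunc N f g i : (i < N)%N ->
  fcoef (fps_mul f g) i = (fps_trunc N f * fps_trunc N g)`_i.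
Proof.
move=> lt_iN; rewrite coefM; apply: eq_bigr => j _.
rewrite !coef_poly (leq_ltn_trans _ lt_iN) ?(leq_ord j) //.
by rewrite (leq_ltn_trans _ lt_iN) ?leq_subr.
Qed.

Fact fps_mulA : associative fps_mul.
Proof.
move=> f g h; apply: fpsP => n.
transitivity ((fps_trunc n.+1 f * (fps_trunc n.+1 g * fps_trunc n.+1 h))`_n).
  rewrite coefM; apply: eq_bigr => j _.
  by rewrite coef_poly ltn_ord -fps_mul_trunc // ltnS leq_subr.
rewrite mulrA coefM; apply: eq_bigr => j _.
by rewrite coef_poly ltnS leq_subr -fps_mul_trunc.
Qed.

Fact fps_mulC : commutative fps_mul.
Proof.
by move=> f g; apply: fpsP => n; rewrite !(@fps_mul_trunc n.+1) // mulrC.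
Qed.

Fact fps_mul1 : left_id fps_one fps_mul.
Proof.
move=> f; apply: fpsP => n /=; rewrite big_ord_recl /= mul1r subn0.
by rewrite big1 ?addr0 // => i _; rewrite mul0r.
Qed.

Fact fps_mulDl : left_distributive fps_mul +%R.
Proof.
move=> f g h; apply: fpsP => n; rewrite fcoefD /= -big_split /=.
by apply: eq_bigr => i _; rewrite mulrDl.
Qed.

Fact fps_one_neq0 : fps_one != 0.
Proof.
by apply/eqP => /(congr1 (fun f => fcoef f 0)) /eqP; rewrite fcoef0 oner_eq0.
Qed.

HB.instance Definition _ := GRing.Zmodule_isComNzRing.Build (fps K)
  fps_mulA fps_mulC fps_mul1 fps_mulDl fps_one_neq0.

Lemma fcoef1 n : fcoef (1 : fps K) n = (n == 0%N)%:R. Proof. by []. Qed.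
Lemma fcoefM f g n :
  fcoef (f * g) n = \sum_(i < n.+1) fcoef f i * fcoef g (n - i).
Proof. by []. Qed.
Lemma fcoef0M f g : fcoef (f * g) 0 = fcoef f 0 * fcoef g 0.
Proof. by rewrite fcoefM big_ord1. Qed.

End FpsRing.

Section FpsUnit.
Variable K : comUnitRingType.
Implicit Types f g : fps K.

Definition fps_unit : {pred fps K} := [pred f | fcoef f 0 \is a GRing.unit].

(* From (f^-1)_0 f_0 = 1 and \sum_(i <= n) (f^-1)_i f_(n-i) = 0 for n > 0. *)
Definition fps_inv_step f (s : seq K) : K :=
  if size s == 0%N then (fcoef f 0)^-1
  else - (\sum_(i < size s) s`_i * fcoef f (size s - i)) / fcoef f 0.

(* Like the other inverses of the library, it is the identity on non-units. *)
Definition fps_inv f : fps K :=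
  if f \in fps_unit then fps_cov (fps_inv_step f) else f.

Fact fps_mulVf : {in fps_unit, left_inverse 1 fps_inv *%R}.
Proof.
move=> f uf; rewrite /fps_inv uf; apply: fpsP => n.
rewrite fcoefM fcoef1 big_ord_recr subnn fps_covE.
rewrite {2}/fps_inv_step size_cov.
case: n => [|n]; first by rewrite /= big_ord0 add0r mulVr.
rewrite /= divrK //; apply/eqP; rewrite subr_eq0; apply/eqP.
by apply: eq_bigr => i _; rewrite (@nth_cov _ _ n.+1).
Qed.

Fact fps_unitPl f g : g * f = 1 -> fps_unit f.
Proof.
move=> /(congr1 (fun h => fcoef h 0)); rewrite fcoef0M fcoef1 => gf1.
by apply/unitrPr; exists (fcoef g 0); rewrite mulrC.
Qed.

Fact fps_inv_out : {in [predC fps_unit], fps_inv =1 id}.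
Proof. by move=> f /negbTE nuf; rewrite /fps_inv nuf. Qed.

HB.instance Definition _ := GRing.ComNzRing_hasMulInverse.Build (fps K)
  fps_mulVf fps_unitPl fps_inv_out.

Lemma fps_unitE f : (f \is a GRing.unit) = (fcoef f 0 \is a GRing.unit).
Proof. by []. Qed.

(* The series with constant term 1 whose square is f; it exists and is unique
   when f has constant term 1 and 2 is a unit (junk value 0 if there is none). *)
Definition fps_sqrt f : fps K :=
  xget 0 [set s : fps K | fcoef s 0 = 1 /\ s ^+ 2 = f]%classic.

(* From 2 s_n + \sum_(0 < i < n) s_i s_(n-i) = f_n for n > 0, where s_0 = 1. *)
Definition fps_sqrt_step f (s : seq K) : K :=
  if size s == 0%N then 1
  else (fcoef f (size s) -
        \sum_(i < (size s).-1) s`_i.+1 * s`_((size s).-1 - i)) / 2%:R.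

Lemma fps_sqrtP f : 2%:R \is a @GRing.unit K -> fcoef f 0 = 1 ->
  fcoef (fps_sqrt f) 0 = 1 /\ fps_sqrt f ^+ 2 = f.
Proof.
move=> u2 f0; pose s := fps_cov (fps_sqrt_step f).
suff Ps : fcoef s 0 = 1 /\ s ^+ 2 = f.
  exact: (@xgetPex _ 0 [set s : fps K | fcoef s 0 = 1 /\ s ^+ 2 = f]%classic
            (ex_intro _ s Ps)).
have s0 : fcoef s 0 = 1 by [].
split=> //; apply: fpsP => -[|n]; first by rewrite expr2 fcoef0M s0 mulr1 f0.
have sE : fcoef s n.+1 =
    (fcoef f n.+1 - \sum_(i < n) fcoef s i.+1 * fcoef s (n - i)) / 2%:R.
  rewrite fps_covE /fps_sqrt_step size_cov.
  congr ((_ - _) / _); apply: eq_bigr => i _.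
  by rewrite !nth_cov // ?ltnS ?leq_subr ?ltn_ord.
rewrite expr2 fcoefM big_ord_recl big_ord_recr lift0 subnn s0 mulr1 mul1r.
have -> : fcoef s (n.+1 - @ord0 n.+1) = fcoef s n.+1 by [].
rewrite (eq_bigr (fun i : 'I_n => fcoef s i.+1 * fcoef s (n - i))) //.
set S := \sum_(i < n) _ in sE *.
transitivity (fcoef s n.+1 * 2%:R + S); last by rewrite sE divrK // subrK.
by rewrite mulr_natr mulr2n -addrA [_ + S]addrC.
Qed.

Lemma fps_sqrt_unique f s : 2%:R \is a @GRing.unit K ->
  fcoef s 0 = 1 -> s ^+ 2 = f -> s = fps_sqrt f.
Proof.
move=> u2 s0 s2.
have f0 : fcoef f 0 = 1 by rewrite -s2 expr2 fcoef0M s0 mulr1.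
have [t0 t2] := fps_sqrtP u2 f0; apply/eqP; rewrite -subr_eq0; apply/eqP.
have u : s + fps_sqrt f \is a GRing.unit by rewrite fps_unitE fcoefD s0 t0.
by apply: (mulIr u); rewrite mul0r -subr_sqr s2 t2 subrr.
Qed.

End FpsUnit.

(* F_T(x); the coefficients are taken in the field of rationals, since the
   closed form divides by series whose constant term is 2. *)
Definition genF (T : seq (seq nat)) : fps rat := Fps (fun n => #|av T n|%:R).

(* Main.v *)
Require Import Defs.
From mathcomp Require Import all_boot all_order all_algebra all_fingroup.
From mathcomp Require Import zify ring.

Set Implicit Arguments.
Unset Strict Implicit.
Unset Printing Implicit Defensive.

Import GRing.Theory.

(* Permutations grow by prepending a letter v and raising the letters >= v by
   one; the allowed v are the sites of w.  Let d be the number of sites v such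
   that the letters >= v are decreasing, and e the number of other sites.
   - If w contains 312, then prepending a non-maximal site v destroys exactly
     the sites below v, and prepending the maximal letter leaves d + 1 sites, all
     of the first kind.  For e = 0 this is the Catalan tree, and in general the
     descendants of w are counted by C^d q^e, where C = 1 + x C^2, q = 1/(1 - x).
   - If w avoids 312, then 0 is a site after prepending v exactly when the letters
     below v are decreasing.  For w not decreasing this holds for exactly two
     sites, and the descendants are counted by B (1 - x) C^d q^e, where
     B = (1 - x)^2/(1 - 3x + x^2).
   - If w is decreasing, they are counted by (1 - B) q + B C^d.
   Each of these series equals 1 + x times the sum over the children; the empty
   word has d = 1 and is decreasing. *)

(** * Forbidden patterns seen from their first letter *)

Definition desc : seq nat -> bool := pairwise geq.

Fixpoint has312 (w : seq nat) : bool :=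
  if w is a :: w' then has312 w' || ~~ desc [seq b <- w' | b < a] else false.

(** With a new letter in front as the 2, [c] is the 3 and is followed by a 4 and a 1. Their order is
    left free, so that one test covers both 2314 and 2341. *)
Fixpoint straddles (v : nat) (w : seq nat) : bool :=
  if w is c :: w' then
    straddles v w' || [&& v <= c, has (ltn c) w' & has (gtn v) w']
  else false.

(** The first condition keeps the new letter from being the 1 of a 1423, the second from being the 2
    of a 2314 or a 2341. *)
Definition site (w : seq nat) (v : nat) : bool :=
  ~~ has312 [seq c <- w | v <= c] && ~~ straddles v w.

(* [site w v] is about a new letter just below the value [v]; as [a] does not
   occur in [w'], it plays the role of a new letter just below [a.+1]. *)
Fixpoint good (w : seq nat) : bool :=
  if w is a :: w' then good w' && site w' a.+1 else true.

Lemma ascentP (s : seq nat) :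
  reflect (exists x y, subseq [:: x; y] s /\ x < y) (~~ desc s).
Proof.
apply: (iffP idP) => [|[x [y [sub_s lt_xy]]]]; last first.
  apply/negP => /(subseq_pairwise sub_s) /=.
  by rewrite /geq /= leqNgt lt_xy.
elim: s => //= a s IHs; rewrite negb_and => /orP[|/IHs[x [y [sub_s lt_xy]]]].
  rewrite -has_predC => /hasP[y ys /=]; rewrite -ltnNge => lt_ay.
  by exists a, y; rewrite eqxx sub1seq ys.
exists x, y; split=> //; exact: (subseq_trans sub_s (subseq_cons s a)).
Qed.

Lemma has312P (w : seq nat) :
  reflect (exists a b c, subseq [:: a; b; c] w /\ b < c < a) (has312 w).
Proof.
apply: (iffP idP) => [|[a [b [c [sub_w /andP[lt_bc lt_ca]]]]]].
  elim: w => //= a w IHw /orP[/IHw[x [y [z [sub_w xyz]]]]|].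
    by exists x, y, z; split=> //; apply: (subseq_trans sub_w (subseq_cons w a)).
  case/ascentP=> b [c []]; rewrite subseq_filter /= => /andP[/and3P[_ lt_ca _] sub_w] lt_bc.
  by exists a, b, c; rewrite eqxx lt_bc.
elim: w sub_w => // a' w IHw.
rewrite [subseq _ _]/=; case: eqP => [<- | _] sub_w; last by rewrite /= IHw.
apply/orP; right; apply/ascentP; exists b, c; split=> //.
by rewrite subseq_filter sub_w /= lt_ca (ltn_trans lt_bc lt_ca).
Qed.

Lemma subseq_pair (x y : nat) (s : seq nat) : x \in s -> y \in s -> x != y ->
  subseq [:: x; y] s || subseq [:: y; x] s.
Proof.
elim: s => // a s IHs; rewrite !inE /=.
case: (eqVneq x a) => [->|_]; case: (eqVneq y a) => [->|_] //=.
- by rewrite sub1seq => _ ->.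
- by rewrite !sub1seq => ->; rewrite orbT.
Qed.

Lemma straddlesP (v : nat) (w : seq nat) :
  reflect (exists c x y, [/\ v <= c, c < x, y < v &
             subseq [:: c; x; y] w || subseq [:: c; y; x] w]) (straddles v w).
Proof.
apply: (iffP idP) => [|[c [x [y [le_vc lt_cx lt_yv sub_w]]]]].
  elim: w => //= a w IHw /orP[/IHw[c [x [y [? ? ? sub_w]]]]|].
    exists c, x, y; split=> //; have sub_a := subseq_cons w a.
    by apply/orP; case/orP: sub_w => sub_w; [left | right]; apply: subseq_trans sub_w sub_a.
  case/and3P=> le_va /hasP[x xw lt_ax] /hasP[y yw lt_yv]; exists a, x, y.
  rewrite eqxx; split=> //; apply: subseq_pair => //.
  move: lt_ax lt_yv => /=; lia.
elim: w sub_w => //= a w IHw; case: eqP => [<- | _] sub_w; last by rewrite IHw.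
have [xw yw] : x \in w /\ y \in w.
  by case/orP: sub_w => /mem_subseq sub_w; split; apply: sub_w; rewrite !inE eqxx ?orbT.
apply/orP; right; apply/and3P; split=> //; apply/hasP.
  by exists x.
by exists y.
Qed.

(** * Avoidance of the three patterns, letter by letter *)

Lemma order_iso4 (s : seq nat) (t1 t2 t3 t4 : nat) :
  order_iso s [:: t1; t2; t3; t4] ->
  exists a b c d, s = [:: a; b; c; d].
Proof.
by case: s => [|a [|b [|c [|d []]]]] // _; exists a, b, c, d.
Qed.

Lemma order_iso_nth (s t : seq nat) : order_iso s t =
  (size s == size t) && all (fun i => all (fun j =>
    (nth 0 s i < nth 0 s j) == (nth 0 t i < nth 0 t j)) (iota 0 (size s))) (iota 0 (size s)).
Proof.
congr (_ && _); apply/forallP/allP => [H i | H i].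
  rewrite mem_iota /= => lt_i; apply/allP => j; rewrite mem_iota /= => lt_j.
  exact: (forallP (H (Ordinal lt_i)) (Ordinal lt_j)).
apply/forallP => j; have /H /allP : val i \in iota 0 (size s) by rewrite mem_iota /=.
by apply; rewrite mem_iota /=.
Qed.

Lemma order_iso1423 (a b c d : nat) :
  order_iso [:: a; b; c; d] [:: 1; 4; 2; 3] = [&& a < c, c < d & d < b].
Proof. rewrite order_iso_nth /=; lia. Qed.

Lemma order_iso2314 (a b c d : nat) :
  order_iso [:: a; b; c; d] [:: 2; 3; 1; 4] = [&& c < a, a < b & b < d].
Proof. rewrite order_iso_nth /=; lia. Qed.

Lemma order_iso2341 (a b c d : nat) :
  order_iso [:: a; b; c; d] [:: 2; 3; 4; 1] = [&& d < a, a < b & b < c].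
Proof. rewrite order_iso_nth /=; lia. Qed.

Lemma contains_cons (a : nat) (w : seq nat) (t1 t2 t3 t4 : nat) :
  let t := [:: t1; t2; t3; t4] in
  contains (a :: w) t <->
  contains w t \/
  exists b c d, subseq [:: b; c; d] w /\ order_iso [:: a; b; c; d] t.
Proof.
move=> t; split.
  case/containsP=> s sub_s iso; have [a' [b [c [d s_def]]]] := order_iso4 iso.
  subst s; move: sub_s; rewrite [subseq _ _]/=; case: eqP => [a'a | _] sub_w.
    by right; exists b, c, d; rewrite -a'a.
  by left; apply/containsP; exists [:: a'; b; c; d].
case=> [/containsP[s sub_s iso] | [b [c [d [sub_w iso]]]]]; apply/containsP.
  by exists s => //; apply: (subseq_trans sub_s (subseq_cons w a)).
by exists [:: a; b; c; d]; rewrite //= eqxx.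
Qed.

Definition T13 : seq (seq nat) := [:: [:: 1; 4; 2; 3]; [:: 2; 3; 1; 4]; [:: 2; 3; 4; 1]].

(** An occurrence of a pattern in [a :: w] either lies in [w] or starts with [a]; in the latter case
    its other three letters are a 312 above [a] or a straddle of [a]. *)
Lemma goodE (w : seq nat) : uniq w -> good w = avoids w T13.
Proof.
elim: w => [_ | a w IHw /= /andP[aw uw]].
  rewrite /avoids /T13 /= andbT; apply/esym/and3P.
  by split; apply/containsP => -[s]; rewrite subseq0 => /eqP->; rewrite order_iso_nth.
have cW t1 t2 t3 t4 := @contains_cons a w t1 t2 t3 t4.
rewrite {}IHw //; apply/idP/idP.
  case/andP=> /and4P[n1 n2 n3 _] /andP[no312 nostr].
  apply/and4P; split=> //; apply/negP => /cW[]; try by apply/negP.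
  - case=> b [c [d [sub_w]]]; rewrite order_iso1423 => lts.
    case/has312P: no312; exists b, c, d; rewrite subseq_filter sub_w /=; lia.
  - case=> b [c [d [sub_w]]]; rewrite order_iso2314 => lts.
    case/straddlesP: nostr; exists b, d, c; rewrite sub_w orbT; split; lia.
  - case=> b [c [d [sub_w]]]; rewrite order_iso2341 => lts.
    case/straddlesP: nostr; exists b, c, d; rewrite sub_w; split; lia.
case/and4P=> /negP n1 /negP n2 /negP n3 _; apply/andP; split.
  apply/and4P; split=> //; apply/negP => cw; [apply: n1|apply: n2|apply: n3];
  by apply/cW; left.
apply/andP; split.
  apply/negP => /has312P[b [c [d [sub_w lts]]]]; apply: n1; apply/cW; right.
  exists b, c, d; move: sub_w; rewrite order_iso1423 subseq_filter /=.
  by case/andP=> ? ->; split=> //; lia.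
apply/negP => /straddlesP[c [x [y [lt_ac lt_cx lt_ya sub_w]]]].
(* The threshold [a.+1] only gives [y <= a]; the letters being distinct, [y] is strictly below
   [a]. *)
have nya : y != a.
  apply: contraNneq aw => <-.
  by case/orP: sub_w => /mem_subseq; apply; rewrite !inE eqxx ?orbT.
case/orP: sub_w => sub_w; [apply: n3 | apply: n2]; apply/cW; right.
  exists c, x, y; rewrite order_iso2341; split=> //; lia.
exists c, y, x; rewrite order_iso2314; split=> //; lia.
Qed.

(** * Invariance under increasing relabelling *)

Lemma filter_map_leq (f : nat -> nat) (u u' : nat) (w : seq nat) :
  (forall x, (u' <= f x) = (u <= x)) ->
  [seq c <- map f w | u' <= c] = map f [seq c <- w | u <= c].
Proof. by move=> fE; rewrite filter_map; congr map; apply: eq_filter => x /=. Qed.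

Lemma filter_map_ltn (f : nat -> nat) (u u' : nat) (w : seq nat) :
  (forall x, (f x < u') = (x < u)) ->
  [seq c <- map f w | c < u'] = map f [seq c <- w | c < u].
Proof. by move=> fE; rewrite filter_map; congr map; apply: eq_filter => x /=. Qed.

Lemma desc_map (f : nat -> nat) (w : seq nat) : {mono f : x y / x <= y} ->
  desc (map f w) = desc w.
Proof. by move=> mf; rewrite /desc pairwise_map; apply: eq_pairwise => x y; apply: mf. Qed.

Lemma has312_map (f : nat -> nat) (w : seq nat) : {mono f : x y / x <= y} ->
  has312 (map f w) = has312 w.
Proof.
move=> mf; elim: w => //= a w ->.
by rewrite (filter_map_ltn (u := a)) ?desc_map // => x; apply: leqW_mono.
Qed.

Lemma straddles_map (f : nat -> nat) (u u' : nat) (w : seq nat) :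
  {mono f : x y / x <= y} -> (forall x, (u' <= f x) = (u <= x)) ->
  straddles u' (map f w) = straddles u w.
Proof.
move=> mf fE; elim: w => //= a w ->; rewrite fE !has_map.
congr (_ || [&& _, _ & _]); apply: eq_has => x /=; first exact: leqW_mono.
by rewrite !ltnNge fE.
Qed.

(** Thresholds are cuts between letters: in [good_map] the cut just above [a] becomes the cut just
    above [f a], so [(f a).+1] replaces [a.+1]. *)
Lemma site_map (f : nat -> nat) (u u' : nat) (w : seq nat) :
  {mono f : x y / x <= y} -> (forall x, (u' <= f x) = (u <= x)) ->
  site (map f w) u' = site w u.
Proof.
move=> mf fE; rewrite /site (filter_map_leq _ fE) has312_map //.
by rewrite (straddles_map _ mf fE).
Qed.

Lemma good_map (f : nat -> nat) (w : seq nat) :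
  {mono f : x y / x <= y} -> good (map f w) = good w.
Proof.
move=> mf; elim: w => //= a w ->; congr (_ && _).
by apply: site_map => // x; apply: leqW_mono.
Qed.

(** * Growth of permutations by prepending a letter *)

Definition prepend (w : seq nat) (v : nat) : seq nat := v :: map (bump v) w.

Lemma bump_succ_leq (u v x : nat) : v <= u -> (u.+1 <= bump v x) = (u <= x).
Proof. rewrite /bump; case: (leqP v x) => /=; lia. Qed.

Lemma bump_mono (v : nat) : {mono bump v : x y / x <= y}.
Proof. by move=> x y; rewrite leq_bump2. Qed.

Lemma inj_bump (v : nat) : injective (bump v).
Proof. exact: incn_inj (bump_mono v). Qed.

Lemma good_prepend (w : seq nat) (v : nat) :
  good (prepend w v) = good w && site w v.
Proof.
rewrite /= (good_map _ (bump_mono v)); congr (_ && _).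
by apply: site_map (bump_mono v) _ => x; apply: bump_succ_leq.
Qed.

Definition is_perm (w : seq nat) : bool := perm_eq w (iota 0 (size w)).

Lemma is_permE (w : seq nat) : is_perm w = uniq w && all (gtn (size w)) w.
Proof.
apply/idP/andP => [pw | [uw lt_w]].
  split; first by rewrite (perm_uniq pw) iota_uniq.
  by apply/allP => x; rewrite (perm_mem pw) mem_iota.
apply: uniq_perm => //; first exact: iota_uniq.
have sub_w : {subset w <= iota 0 (size w)} by move=> x /(allP lt_w); rewrite mem_iota.
by have [] := uniq_min_size uw sub_w; rewrite size_iota.
Qed.

Lemma mem_is_perm (w : seq nat) (x : nat) : is_perm w -> (x \in w) = (x < size w).
Proof. by move=> pw; rewrite (perm_mem pw) mem_iota. Qed.

Lemma is_perm_prepend (w : seq nat) (v : nat) :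
  is_perm w -> v <= size w -> is_perm (prepend w v).
Proof.
rewrite !is_permE => /andP[uw /allP lt_w] le_v; rewrite /= size_map ltnS le_v.
rewrite (map_inj_uniq (@inj_bump v)) uw andbT /=; apply/andP; split.
  by apply/mapP => -[x _ /eqP]; rewrite eqn_leq /bump; case: (leqP v x) => /=; lia.
by apply/allP => _ /mapP[x /lt_w /= lt_x ->]; rewrite /bump; case: (v <= x); lia.
Qed.

Definition words (n : nat) : seq (seq nat) := permutations (iota 0 n).

Lemma mem_words (n : nat) (w : seq nat) : (w \in words n) = is_perm w && (size w == n).
Proof.
rewrite mem_permutations /is_perm.
apply/idP/andP => [pw | [pw /eqP <-] //].
by rewrite (perm_size pw) size_iota eqxx.
Qed.

Lemma size_words (n : nat) : size (words n) = n`!.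
Proof. by rewrite size_permutations ?iota_uniq // size_iota. Qed.

Lemma uniq_perm_words (n : nat) (s : seq (seq nat)) :
  uniq s -> {subset s <= words n} -> size s = n`! -> perm_eq s (words n).
Proof.
move=> us sub_s size_s; apply: uniq_perm => //; first exact: permutations_uniq.
by have [] := uniq_min_size us sub_s; rewrite // size_words size_s.
Qed.

(** The first letter gives back [v], and [bump v] is injective; surjectivity follows by counting,
    from [(n + 1) * n! = (n + 1)!]. *)
Lemma words_succ (n : nat) :
  perm_eq [seq prepend w v | w <- words n, v <- iota 0 n.+1] (words n.+1).
Proof.
apply: uniq_perm_words.
- apply: allpairs_uniq; [exact: permutations_uniq | exact: iota_uniq|].
  move=> [w v] [w' v'] _ _ /= [vv' ww']; move: ww'; rewrite vv'.
  by move/(inj_map (@inj_bump v')) => ->.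
- move=> _ /allpairsP[[w v] /= [ww vn ->]].
  move: ww vn; rewrite !mem_words -[0 :: _]/(iota 0 n.+1) mem_iota ltnS => /andP[pw /eqP <-] le_v.
  by rewrite is_perm_prepend //= size_map eqxx.
by rewrite size_allpairs size_words size_iota factS mulnC.
Qed.

Lemma card_av (n : nat) : #|av T13 n| = count good (words n).
Proof.
pose word (p : 'S_n) := [seq val (p i) | i <- enum 'I_n].
have pw : perm_eq [seq word p | p : 'S_n] (words n).
  apply: uniq_perm_words; last by rewrite size_map -cardE card_Sn.
    rewrite map_inj_uniq ?enum_uniq // => p q /eq_in_map pq.
    by apply/permP => i; apply/val_inj/pq; rewrite mem_enum.
  move=> _ /mapP[p _ ->]; rewrite mem_words is_permE.
  rewrite size_map size_enum_ord eqxx andbT; apply/andP; split.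
    by rewrite (map_inj_uniq (inj_comp val_inj perm_inj)) enum_uniq.
  by apply/allP => _ /mapP[i _ ->] /=.
rewrite -(seq.permP pw) count_map cardE size_filter enumT; apply: eq_count => p.
(* The one-line word has letters from 1 on; [good] is invariant under the shift. *)
transitivity (avoids (map S (word p)) T13); first by rewrite [LHS]inE -map_comp.
rewrite -goodE ?good_map // !map_inj_uniq -?enumT ?enum_uniq //; last by move=> i j [].

by move=> i j /val_inj/perm_inj.
Qed.

(** * Sites and their change under prepending *)

Definition sites (w : seq nat) : seq nat := [seq v <- iota 0 (size w).+1 | site w v].

Definition dectop (w : seq nat) (v : nat) : bool := desc [seq c <- w | v <= c].
Definition decbot (w : seq nat) (v : nat) : bool := desc [seq c <- w | c < v].

Fixpoint descendants (m : nat) (w : seq nat) : nat :=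
  if m is m'.+1 then \sum_(v <- sites w) descendants m' (prepend w v) else 1.

Lemma count_good (n m : nat) :
  count good (words (n + m)) = \sum_(w <- words n | good w) descendants m w.
Proof.
elim: m n => [|m IHm] n; first by rewrite addn0 sum1_count.
rewrite addnS -addSn IHm -(perm_big _ (words_succ n)) big_mkcond big_allpairs_dep.
rewrite [RHS]big_mkcond; apply: eq_big_seq => w; rewrite mem_words => /andP[_ /eqP <-].
rewrite [descendants _ _]/= /sites big_filter [in RHS]big_mkcond.
case gw: (good w); last first.
  by rewrite big1 // => v _; rewrite good_prepend gw.
by apply: eq_bigr => v _; rewrite good_prepend gw.
Qed.

Lemma desc_cons (a : nat) (w : seq nat) : desc (a :: w) = all (geq a) w && desc w.
Proof. by []. Qed.

Lemma desc_subseq (s w : seq nat) : subseq s w -> desc w -> desc s.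
Proof. exact: subseq_pairwise. Qed.

Lemma desc_has312 (w : seq nat) : desc w -> ~~ has312 w.
Proof.
move=> dw; apply/has312P => -[a [b [c [sub_w /andP[lt_bc _]]]]].
have := desc_subseq sub_w dw; rewrite /desc /= /geq /=; lia.
Qed.

(** Both obstructions to a site, a 312 and a straddle, contain an ascent among the letters
    [>= v]. *)
Lemma dectop_site (w : seq nat) (v : nat) : dectop w v -> site w v.
Proof.
move=> dw; apply/andP; split; first exact: desc_has312.
apply/straddlesP => -[c [x [y [le_vc lt_cx _ sub_w]]]].
have: subseq [:: c; x] [seq c <- w | v <= c].
  rewrite subseq_filter /= le_vc (leq_trans le_vc (ltnW lt_cx)) /=.
  case/orP: sub_w; apply: subseq_trans; rewrite /= !eqxx //.
  by case: ifP => //= _; rewrite eqxx.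
move/desc_subseq/(_ dw); rewrite /desc /= /geq /=; lia.
Qed.

Lemma dectop_leq (w : seq nat) (u v : nat) : u <= v -> dectop w u -> dectop w v.
Proof.
move=> le_uv; apply: desc_subseq.
rewrite subseq_filter filter_subseq andbT; apply/allP => x.
by rewrite mem_filter => /andP[le_vx _]; apply: leq_trans le_vx.
Qed.

Lemma dectop0 (w : seq nat) : dectop w 0 = desc w.
Proof. by rewrite /dectop filter_predT. Qed.

Lemma decbot_size (w : seq nat) : is_perm w -> decbot w (size w) = desc w.
Proof.
by rewrite is_permE /decbot => /andP[_ /all_filterP ->].
Qed.

Lemma dectop_size (w : seq nat) : is_perm w -> dectop w (size w).
Proof.
rewrite is_permE /dectop => /andP[_ /allP lt_w].
rewrite (eq_in_filter (a2 := pred0)) ?filter_pred0 // => x /lt_w.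
exact: ltn_geF.
Qed.

Lemma site0 (w : seq nat) : site w 0 = ~~ has312 w.
Proof.
rewrite /site filter_predT; case: straddlesP; last by rewrite andbT.
by case=> c [x [y []]].
Qed.

Lemma size_mem_sites (w : seq nat) : is_perm w -> size w \in sites w.
Proof. by move=> pw; rewrite mem_filter mem_iota ltnSn dectop_site ?dectop_size. Qed.

Lemma site_prepend_succ (w : seq nat) (u v : nat) :
  v <= u -> site (prepend w v) u.+1 = site w u.
Proof.
move=> le_vu; rewrite /prepend /site /= [u < v]ltnNge le_vu /= orbF.
by apply: site_map (bump_mono v) _ => x; apply: bump_succ_leq.
Qed.

Lemma dectop_prepend_succ (w : seq nat) (u v : nat) :
  v <= u -> dectop (prepend w v) u.+1 = dectop w u.
Proof.
move=> le_vu; rewrite /dectop /= [u < v]ltnNge le_vu /=.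
rewrite (filter_map_leq (u := u)) ?desc_map //; first exact: bump_mono.
by move=> x; apply: bump_succ_leq.
Qed.

(** The new letter [v] itself straddles [u]: it is followed by the maximum, which exceeds it because
    [v < size w], and by 0, which is below [u]. *)
Lemma site_prepend_leq (w : seq nat) (u v : nat) : is_perm w ->
  v < size w -> 0 < u <= v -> site (prepend w v) u = false.
Proof.
move=> pw lt_v /andP[u_gt0 le_uv]; apply: contraTF lt_v => /andP[_ /=].
rewrite negb_or le_uv /= => /andP[_]; apply: contraNN => lt_v; apply/andP; split.
  apply/hasP; exists (bump v (size w).-1); last by rewrite /= /bump; lia.
  by rewrite map_f // mem_is_perm //; lia.
apply/hasP; exists (bump v 0); last by rewrite /= /bump; lia.
by rewrite map_f // mem_is_perm //; lia.
Qed.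

Lemma bump_ltn_self (v x : nat) : (bump v x < v) = (x < v).
Proof. by rewrite /bump; case: (leqP v x) => /=; lia. Qed.

Lemma has312_prepend (w : seq nat) (v : nat) :
  has312 (prepend w v) = has312 w || ~~ decbot w v.
Proof.
rewrite /= has312_map ?(filter_map_ltn (u := v)) ?desc_map //; try exact: bump_mono.
exact: bump_ltn_self.
Qed.

Lemma desc_prepend (w : seq nat) (v : nat) : is_perm w -> v <= size w ->
  desc (prepend w v) = (v == size w) && desc w.
Proof.
move=> pw le_v; rewrite desc_cons desc_map; last exact: bump_mono.
congr (_ && _); rewrite all_map; apply/allP/eqP => [ge_v | -> x].
  apply/eqP; rewrite eqn_leq le_v /= leqNgt; apply/negP => lt_v.
  have /ge_v : (size w).-1 \in w by rewrite mem_is_perm //; lia.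
  by rewrite /= /geq /bump /=; lia.
by rewrite mem_is_perm // /= /geq /bump /=; lia.
Qed.

Lemma sites_prepend (w : seq nat) (v : nat) : is_perm w -> v < size w ->
  sites (prepend w v) = (if has312 w || ~~ decbot w v then [::] else [:: 0])
     ++ map S [seq u <- sites w | v <= u].
Proof.
move=> pw lt_v; have -> : sites (prepend w v) =
    [seq u <- 0 :: map S (iota 0 (size w).+1) | site (prepend w v) u].
  by rewrite /sites [size _]/= size_map -(iotaDl 1 0).
rewrite /sites; move: (iota 0 _) => r; rewrite /= site0 has312_prepend -filter_predI filter_map.
rewrite (eq_filter (a2 := predI (leq v) (site w))) => [|u /=]; first by case: (_ || _).
case: leqP => [/site_prepend_succ // | lt_uv].
by rewrite site_prepend_leq.
Qed.

Lemma prepend_size (w : seq nat) : is_perm w -> prepend w (size w) = size w :: w.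
Proof.
move=> pw; congr (_ :: _); rewrite -[RHS]map_id; apply/eq_in_map => x.
by rewrite mem_is_perm // /bump => /ltn_geF ->.
Qed.

Lemma dectop_prepend_size (w : seq nat) (u : nat) : is_perm w -> u <= size w ->
  dectop (prepend w (size w)) u = dectop w u.
Proof.
move=> pw le_u; rewrite prepend_size // /dectop /= le_u desc_cons.
rewrite [all _ _](_ : _ = true) //; apply/allP => x; rewrite mem_filter mem_is_perm //.
by rewrite /geq /= => /andP[_ /ltnW].
Qed.

(** An ascent among the letters [>= u] forms a 312 with the maximum now in front. *)
Lemma site_prepend_size (w : seq nat) (u : nat) : is_perm w -> u <= size w ->
  site (prepend w (size w)) u = dectop w u.
Proof.
move=> pw le_u; apply/idP/idP => [/andP[no312 _] | dw]; last first.
  by rewrite dectop_site // dectop_prepend_size.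
move: no312; rewrite prepend_size //= le_u /= negb_or negbK => /andP[_].
congr desc; rewrite -filter_predI; apply: eq_in_filter => x.
by rewrite mem_is_perm //= => ->.
Qed.

Lemma sites_prepend_size (w : seq nat) : is_perm w ->
  sites (prepend w (size w)) =
  rcons [seq u <- iota 0 (size w).+1 | dectop w u] (size w).+1.
Proof.
move=> pw; have -> : sites (prepend w (size w)) =
    [seq u <- iota 0 (size w).+1 ++ [:: (size w).+1] | site (prepend w (size w)) u].
  by rewrite /sites [size (prepend _ _)]/= size_map -[X in iota 0 X]addn1 iotaD.
rewrite filter_cat [filter _ [:: _]]/= site_prepend_succ // dectop_site ?dectop_size // cats1.
congr rcons; apply: eq_in_filter => u; rewrite mem_iota => /andP[_].
exact: site_prepend_size.
Qed.

(* In a word that avoids 312 and is not decreasing, the entries below a site are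
   decreasing for exactly two sites, one of which is [0]. *)
Definition two_decbot (w : seq nat) : Prop :=
  ~~ has312 w -> ~~ desc w ->
  exists a s, [/\ sites w = [:: 0, a & s], decbot w a & all (predC (decbot w)) s].

Lemma filter_leq_sorted (s : seq nat) (v : nat) : sorted ltn s -> v \in s ->
  [seq u <- s | v <= u] = v :: [seq u <- s | v < u].
Proof.
elim: s => //= a s IHs; rewrite path_sortedE; last exact: ltn_trans.
case/andP=> /allP lt_as s_sorted; rewrite inE => /orP[/eqP -> | vs].
  rewrite leqnn ltnn; congr (_ :: _); apply: eq_in_filter => u /lt_as; lia.
have lt_av : a < v := lt_as v vs.
by rewrite leqNgt lt_av ltnNge (ltnW lt_av) /=; apply: IHs.
Qed.

Lemma sites_sorted (w : seq nat) : sorted ltn (sites w).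
Proof. exact: (sorted_filter ltn_trans _ (iota_ltn_sorted 0 _)). Qed.

(** Under the two assumptions of [two_decbot], [v] is not maximal, and the sites of the new word are
    0, [v.+1] and larger ones. Below [v.+1] lie [v] and then a decreasing word; below a larger site
    there is the ascent from [v] to [v.+1]. *)
Lemma two_decbot_prepend (w : seq nat) (v : nat) : is_perm w -> v \in sites w ->
  two_decbot (prepend w v).
Proof.
move=> pw vs; have := vs; rewrite mem_filter mem_iota add0n ltnS => /andP[_ le_v].
rewrite /two_decbot has312_prepend desc_prepend // negb_or negbK => /andP[no312 dv].
case: (eqVneq v (size w)) dv => [-> | ne_v] dv /=; first by rewrite -decbot_size // dv.
move=> _; have lt_v : v < size w by rewrite ltn_neqAle ne_v.
exists v.+1, (map S [seq u <- sites w | v < u]); split.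
- rewrite sites_prepend // (negPf no312) dv /= filter_leq_sorted //.
  exact: sites_sorted.
- rewrite /decbot /= ltnSn (filter_map_ltn (u := v)) => [|x]; last first.
    by rewrite /bump; case: (leqP v x) => /=; lia.
  rewrite desc_cons desc_map -/(decbot w v) ?dv ?andbT; last exact: bump_mono.
  apply/allP => _ /mapP[x /[!mem_filter] /andP[lt_x _] ->].
  by rewrite /= -bump_ltn_self in lt_x *; apply: ltnW.
rewrite all_map; apply/allP => u; rewrite mem_filter /= => /andP[lt_vu _].
rewrite /decbot /= ltnS (ltnW lt_vu) desc_cons negb_and; apply/orP; left.
apply/allPn; exists v.+1; last by rewrite /= -ltnNge.
rewrite mem_filter ltnS lt_vu; apply/mapP; exists v; first by rewrite mem_is_perm.
by rewrite /bump leqnn.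
Qed.

Local Open Scope ring_scope.

(** * Weights and the functional equation *)

Section Weight.

Variables (R : comNzRingType) (x C q B : R).
Hypotheses (CE : C = 1 + x * C ^+ 2) (qE : (1 - x) * q = 1).
Hypothesis BE : B * (1 - 3%:R * x + x ^+ 2) = (1 - x) ^+ 2.

Definition weight (P : pred nat) (s : seq nat) : R :=
  C ^+ count P s * q ^+ count (predC P) s.

Lemma weight_cons (P : pred nat) (a : nat) (s : seq nat) :
  weight P (a :: s) = (if P a then C else q) * weight P s.
Proof.
by rewrite /weight /=; case: (P a); rewrite /= !(add0n, add1n) exprS; ring.
Qed.

Lemma weight_all (P : pred nat) (s : seq nat) :
  all P s -> weight P s = C ^+ count P s.
Proof.
move=> allP_s; rewrite /weight (_ : count (predC P) s = 0%N) ?mulr1 //.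
by apply/eqP; rewrite -leqn0 leqNgt -has_count has_predC allP_s.
Qed.

(** The sum telescopes: a site outside [P] is absorbed by [x q = q - 1], a site in [P] by
    [x C^2 = C - 1]. Since [P] is upward closed, the sites after one in [P] are all in [P]. *)
Lemma sum_weight (P : pred nat) (s : seq nat) : sorted ltn s ->
  (forall a b, (a <= b)%N -> P a -> P b) ->
  x * (\sum_(v <- s) weight P [seq u <- s | v <= u]%N) =
  weight P s - x * C ^+ (count P s).+1 - 1 + x * C.
Proof.
move=> ss upP; elim: s ss => [_ | a s IHs].
  by rewrite big_nil /weight /= !expr0; ring.
rewrite /= path_sortedE; last exact: ltn_trans.
case/andP=> /allP lt_as /IHs {}IHs.
rewrite big_cons /= leqnn mulrDr (eq_big_seq (fun v => weight P [seq u <- s | v <= u]%N)).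
  2: by move=> v /lt_as /ltn_geF /= ->.
rewrite IHs (_ : [seq u <- s | a <= u]%N = s); last first.
  by apply/all_filterP/allP => u /lt_as /ltnW.
rewrite weight_cons; case Pa: (P a); last first.
  rewrite add0n; have -> : x * (q * weight P s) = (q - (1 - x) * q) * weight P s by ring.
  by rewrite qE; ring.
have allP_s : all P s by apply/allP => u /lt_as /ltnW /upP; apply.
rewrite (weight_all allP_s) add1n !exprS; set y := C ^+ _.
have -> : C * y - x * (C * (C * y)) = (C - x * C ^+ 2) * y by ring.
have -> : C - x * C ^+ 2 = 1 by rewrite {1}CE addrK.
by ring.
Qed.

(* The generating function of the words that grow from [w]. *)
Definition phi (w : seq nat) : R :=
  if has312 w then weight (dectop w) (sites w)
  else if desc w then (1 - B) * q + B * C ^+ count (dectop w) (sites w)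
  else B * (1 - x) * weight (dectop w) (sites w).

Definition above (w : seq nat) (v : nat) : R :=
  weight (dectop w) [seq u <- sites w | v <= u]%N.

Definition factor (w : seq nat) (v : nat) : R :=
  if has312 w || ~~ decbot w v then 1 else B.

(** If the new word avoids 312, it gains the site 0. As it is not decreasing, this site weighs [q],
    which cancels the [1 - x] in [phi] and leaves [B]. *)
Lemma phi_prepend (w : seq nat) (v : nat) : is_perm w -> (v < size w)%N ->
  phi (prepend w v) = factor w v * above w v.
Proof.
move=> pw lt_v; rewrite /phi has312_prepend desc_prepend 1?ltnW //.
rewrite (ltn_eqF lt_v) /= sites_prepend // /factor.
have -> b : weight (dectop (prepend w v)) ((if b then [::] else [:: 0%N]) ++
    map S [seq u <- sites w | v <= u]%N) = (if b then 1 else q) * above w v.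
  have aboveE : weight (dectop (prepend w v)) (map S [seq u <- sites w | v <= u]%N) = above w v.
    rewrite /above /weight !count_map; congr (_ ^+ _ * _ ^+ _);
    apply: eq_in_count => u; rewrite mem_filter /= => /andP[le_vu _];
    by rewrite dectop_prepend_succ.
  case: b; rewrite /= ?mul1r // weight_cons aboveE.
  by rewrite dectop0 desc_prepend 1?ltnW // (ltn_eqF lt_v).
case: (_ || _) => //; by rewrite -mulrA [(1 - x) * _]mulrA qE mul1r.
Qed.

(** All sites of the new word are of the first kind. Unless [w] is decreasing, the maximum in front
    of an ascent is a 312, so [phi] is the bare weight. *)
Lemma phi_prepend_size (w : seq nat) : is_perm w ->
  let y := C ^+ (count (dectop w) (sites w)).+1 in
  phi (prepend w (size w)) = if desc w then (1 - B) * q + B * y else y.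
Proof.
move=> pw y; have pw' := is_perm_prepend pw (leqnn _).
have all_top : all (dectop (prepend w (size w))) (sites (prepend w (size w))).
  rewrite sites_prepend_size // all_rcons dectop_prepend_succ // dectop_size // andTb.
  apply/allP => u; rewrite mem_filter mem_iota => /andP[dw /andP[_ le_u]].
  by rewrite dectop_prepend_size.
have sizeE : size (sites (prepend w (size w))) = (count (dectop w) (sites w)).+1.
  rewrite sites_prepend_size // size_rcons size_filter count_filter; congr _.+1.
  by apply: eq_count => u /=; case dw: (dectop w u); rewrite //= dectop_site.
have count_top : count (dectop (prepend w (size w))) (sites (prepend w (size w))) =
    (count (dectop w) (sites w)).+1 by rewrite -sizeE; apply/eqP; rewrite -all_count.
rewrite /phi (weight_all all_top) count_top has312_prepend desc_prepend // eqxx decbot_size //=.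
case: ifP => [/orP[no312 | /negPf -> //] | /negbT]; last first.
  by rewrite negb_or negbK => /andP[_ ->].
by case dw: (desc w) => //; rewrite (negPf (desc_has312 dw)) in no312.
Qed.

(** The formula of [phi_prepend] is summed over all sites and then corrected at the maximal one,
    where [above] equals [C]. *)
Lemma sum_phi (w : seq nat) : is_perm w ->
  \sum_(v <- sites w) phi (prepend w v) =
  \sum_(v <- sites w) factor w v * above w v
    + phi (prepend w (size w)) - factor w (size w) * C.
Proof.
move=> pw; have us := sorted_uniq ltn_trans ltnn (sites_sorted w).
rewrite !(bigD1_seq _ (size_mem_sites pw) us) /=.
have -> : above w (size w) = C.
  rewrite /above filter_leq_sorted ?sites_sorted ?size_mem_sites //.
  rewrite (eq_in_filter (a2 := pred0)) => [|u]; last first.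
    by rewrite mem_filter mem_iota add0n ltnS => /andP[_]; apply: leq_gtF.
  by rewrite filter_pred0 weight_cons dectop_size // /weight !expr0 !mulr1.
rewrite (_ : \sum_(v <- sites w | v != size w) phi (prepend w v) =
  \sum_(v <- sites w | v != size w) factor w v * above w v); first by ring.
rewrite big_seq_cond [RHS]big_seq_cond; apply: eq_bigr => v /andP[].
rewrite mem_filter mem_iota add0n ltnS => /andP[_ le_v] ne_v.
by rewrite phi_prepend // ltn_neqAle ne_v.
Qed.

Lemma phi_rec (w : seq nat) : is_perm w -> two_decbot w ->
  phi w = 1 + x * \sum_(v <- sites w) phi (prepend w v).
Proof.
move=> pw shape; rewrite sum_phi // phi_prepend_size //.
have xsum : x * \sum_(v <- sites w) above w v = _ :=
  sum_weight (sites_sorted w) (@dectop_leq w).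
set d := count _ _ in xsum *; rewrite !mulrDr mulrN /phi -/d.
(* With a 312 all factors are 1, and the correction at the maximal site cancels the boundary terms
   of [sum_weight]. *)
case c312: (has312 w).
  have -> : desc w = false by apply: contraTF c312; apply: desc_has312.
  rewrite (eq_bigr (above w)) => [|v _]; last by rewrite /factor c312 mul1r.
  by rewrite xsum /factor c312 /=; ring.
case dw: (desc w).
  (* In a decreasing word every factor is [B] and every site weighs [C]. *)
  have factorE v : factor w v = B.
    by rewrite /factor c312 /decbot (desc_subseq (filter_subseq _ _) dw).
  rewrite (eq_bigr (fun v => B * above w v)) => [|v _]; last by rewrite factorE.
  rewrite -mulr_sumr mulrCA xsum factorE weight_all; last first.
    by apply/allP => u _; apply: (dectop_leq (leq0n u)); rewrite dectop0.
  have DE : (1 - B) * q = 1 - B + x * ((1 - B) * q).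
    by rewrite -{2}[1 - B]mulr1 -qE; ring.
  by rewrite {1}DE; ring.
have [a [s [sitesE da /allP ns]]] := shape (negbT c312) (negbT dw).
have : sorted ltn (sites w) := sites_sorted w.
rewrite sitesE /= path_sortedE; last exact: ltn_trans.
case/and3P=> a_gt0 /allP lt_as _.
pose t := weight (dectop w) (a :: s).
have wE : weight (dectop w) [:: 0%N, a & s] = q * t by rewrite weight_cons dectop0 dw.
have above0 : above w 0 = q * t by rewrite /above filter_predT sitesE wE.
have abovea : above w a = t.
  rewrite /above sitesE /= leqn0 gtn_eqF // leqnn (_ : [seq u <- s | a <= u]%N = s) //.
  by apply/all_filterP/allP => u /lt_as /ltnW.
move: xsum; rewrite sitesE wE !big_cons above0 abovea => xsum.
have -> : factor w 0 = B by rewrite /factor c312 /decbot filter_pred0.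
have -> : factor w a = B by rewrite /factor c312 da.
have -> : factor w (size w) = 1 by rewrite /factor c312 decbot_size // dw.
rewrite (eq_big_seq (above w)) => [|v /ns nv]; last first.
  by rewrite /factor c312 (nv : ~~ decbot w v) mul1r.
(* This is the condition on [B] left after dividing the recursion by [t]; multiplied by [1 - x], it
   becomes [BE]. *)
have BqE : B * (1 - x) = 1 - x + x * (B * q).
  transitivity (B * (1 - x) * ((1 - x) * q)); first by rewrite qE mulr1.
  have uE : 1 - x = B * (1 - 3%:R * x + x ^+ 2) * q.
    by rewrite BE expr2 -mulrA qE mulr1.
  by rewrite [1 - x in RHS]uE; ring.
have xS : x * \sum_(v <- s) above w v =
    t - x * C ^+ d.+1 - 1 + x * C - x * t.
  transitivity (x * (q * t + (t + \sum_(v <- s) above w v)) - x * (q * t) - x * t).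
    by ring.
  have tE : q * t = t + x * (q * t) by rewrite -{2}[t]mul1r -qE; ring.
  by rewrite xsum -/d {1}tE; ring.
have -> : B * (1 - x) * (q * t) = B * (1 - x) * t + x * B * t.
  by rewrite -mulrA [(1 - x) * _]mulrA qE; ring.
by rewrite BqE !mulrDr xS; ring.
Qed.

End Weight.

(** * Comparison of coefficients *)

Lemma fcoef_sum (K : nzRingType) (I : Type) (s : seq I) (F : I -> fps K) (n : nat) :
  fcoef (\sum_(i <- s) F i) n = \sum_(i <- s) fcoef (F i) n.
Proof. by apply: (big_morph (fun f => fcoef f n)) => // f g; rewrite fcoefD. Qed.

Lemma fcoefX0 (K : comNzRingType) (f : fps K) : fcoef (fpsX * f) 0 = 0.
Proof. by rewrite fcoef0M mul0r. Qed.

Lemma fcoefXS (K : comNzRingType) (f : fps K) (n : nat) :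
  fcoef (fpsX * f) n.+1 = fcoef f n.
Proof.
rewrite fcoefM big_ord_recl mul0r add0r big_ord_recl big1 ?addr0 => [|i _].
  by rewrite mul1r /= subn1.
by rewrite mul0r.
Qed.

(** Read coefficientwise, [phi_rec] is the recursion that defines [descendants]; every child
    satisfies [two_decbot] again. *)
Lemma descendants_phi (C q B : fps rat) :
  C = 1 + fpsX * C ^+ 2 -> (1 - fpsX) * q = 1 ->
  B * (1 - 3%:R * fpsX + fpsX ^+ 2) = (1 - fpsX) ^+ 2 ->
  forall (m : nat) (w : seq nat), is_perm w -> two_decbot w ->
  fcoef (phi fpsX C q B w) m = (descendants m w)%:R.
Proof.
move=> CE qE BE; elim=> [|m IHm] w pw shape; rewrite (phi_rec CE qE BE pw shape).
  by rewrite fcoefD fcoefX0 addr0.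
rewrite fcoefD fcoefXS add0r fcoef_sum natr_sum; apply: eq_big_seq => v vs.
apply: IHm; last exact: two_decbot_prepend.
by move: vs; rewrite mem_filter mem_iota => /andP[_ /andP[_ le_v]]; apply: is_perm_prepend.
Qed.

Lemma genF_phi (C q B : fps rat) :
  C = 1 + fpsX * C ^+ 2 -> (1 - fpsX) * q = 1 ->
  B * (1 - 3%:R * fpsX + fpsX ^+ 2) = (1 - fpsX) ^+ 2 ->
  genF T13 = (1 - B) * q + B * C.
Proof.
(* The empty word has the single site 0, so its [phi] computes to the right-hand side. *)
move=> CE qE BE; transitivity (phi fpsX C q B [::]) => //.
apply: fpsP => n; rewrite (descendants_phi CE qE BE) // /genF /= card_av.
by rewrite -[n]add0n count_good big_cons big_nil addn0.
Qed.

(** * The closed form *)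

Lemma closed_form (R : comUnitRingType) (x r C q B : R) :
  1 - x \is a GRing.unit -> 1 - 3%:R * x + x ^+ 2 \is a GRing.unit ->
  1 - 2%:R * x + r \is a GRing.unit -> 1 + r \is a GRing.unit ->
  r ^+ 2 = 1 - 4%:R * x -> C * (1 + r) = 2%:R -> (1 - x) * q = 1 ->
  B * (1 - 3%:R * x + x ^+ 2) = (1 - x) ^+ 2 ->
  (1 - B) * q + B * C =
    (1 - 4%:R * x + 5%:R * x ^+ 2 - x ^+ 3
       + (1 - 4%:R * x + 3%:R * x ^+ 2 - x ^+ 3) * r)
    / ((1 - x) * (1 - 3%:R * x + x ^+ 2) * (1 - 2%:R * x + r)).
Proof.
move=> ux ud ur u1r r2 CE qE BE.
set d := 1 - 3%:R * x + x ^+ 2 in ud BE *.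
apply: (canRL (mulrK _)); first by rewrite !unitrM ux ud.
apply: (mulIr u1r).
(* The factors are grouped into [B * d], [(1 - x) * q] and [C * (1 + r)], whose values are known. *)
transitivity (((d - B * d) * ((1 - x) * q) * (1 + r) + B * d * (1 - x) * (C * (1 + r)))
              * (1 - 2%:R * x + r)); first by ring.
rewrite BE CE qE /d.
transitivity ((-x * (1 + r) + 2%:R * (1 - x) ^+ 3) * (1 - 2%:R * x + r)); first by ring.
apply/eqP; rewrite -subr_eq0; apply/eqP.
(* The difference of the two sides is quadratic in [r], and the cofactor is its coefficient of
   [r ^+ 2]. *)
transitivity ((- x - (1 - 4%:R * x + 3%:R * x ^+ 2 - x ^+ 3)) * (r ^+ 2 - (1 - 4%:R * x))).
  by ring.
by rewrite r2 subrr mulr0.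
Qed.

Theorem theorem13 :
  let T : seq (seq nat) := [:: [:: 1; 4; 2; 3]; [:: 2; 3; 1; 4]; [:: 2; 3; 4; 1]]%N in
  let x : fps rat := fpsX in
  let r : fps rat := fps_sqrt (1 - 4%:R * x) in
  genF T =
    (1 - 4%:R * x + 5%:R * x ^+ 2 - x ^+ 3
       + (1 - 4%:R * x + 3%:R * x ^+ 2 - x ^+ 3) * r)
    / ((1 - x) * (1 - 3%:R * x + x ^+ 2) * (1 - 2%:R * x + r)).
Proof.
move=> T x r.
have x0 f : fcoef (x * f) 0 = 0 := fcoefX0 f.
have [r0 r2] : fcoef r 0 = 1 /\ r ^+ 2 = 1 - 4%:R * x.
  by apply: fps_sqrtP; rewrite ?unitfE // fcoefD fcoefN mulrC x0 subr0.
have ux : 1 - x \is a GRing.unit by rewrite fps_unitE fcoefD fcoefN subr0.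
have ud : 1 - 3%:R * x + x ^+ 2 \is a GRing.unit.
  by rewrite fps_unitE expr2 [_ * x]mulrC !fcoefD fcoefN !x0 subr0 addr0.
have ur : 1 - 2%:R * x + r \is a GRing.unit.
  by rewrite fps_unitE [_ * x]mulrC !fcoefD fcoefN r0 x0.
have u1r : 1 + r \is a GRing.unit by rewrite fps_unitE fcoefD r0.
(* This is the Catalan series [(1 - r) / (2 x)], rationalised because [x] is not a unit. *)
pose C := 2%:R / (1 + r); pose q := (1 - x)^-1.
pose B := (1 - x) ^+ 2 / (1 - 3%:R * x + x ^+ 2).
have C1r : C * (1 + r) = 2%:R by rewrite divrK.
have qE : (1 - x) * q = 1 by rewrite divrr.
have BE : B * (1 - 3%:R * x + x ^+ 2) = (1 - x) ^+ 2 by rewrite divrK.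
have CE : C = 1 + x * C ^+ 2.
  apply: (mulIr u1r); apply: (mulIr u1r).
  transitivity (C * (1 + r) * (1 + r)); first by ring.
  transitivity (1 + 2%:R * r + r ^+ 2 + x * (C * (1 + r)) ^+ 2); last by ring.
  by rewrite C1r r2; ring.
by rewrite -(closed_form ux ud ur u1r r2 C1r qE BE); apply: genF_phi.
Qed.
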